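(* If a bi-nested sequent $S$ is provable in the calculus $\mathbf{C}_{\mathbf{LIK}}$, then $S$ is valid, i.e. $\mathcal{M},x\Vdash S$ for every model $\mathcal{M}=(W,\leq,R,V)$ based on a forward and downward confluent frame and every $x\in W$.
   Context: Formulas: $A::=p\mid A\supset A\mid \top\mid\bot\mid A\vee A\mid A\wedge A\mid \square A\mid \lozenge A$. Frames $(W,\leq,R)$: $W\ne\emptyset$, $\leq$ preorder, $R$ binary relation; forward confluent: $x\leq x'$, $Rxy$ imply some $y'$ with $Rx'y'$, $y\leq y'$; downward confluent: $x\leq x'$, $Rx'y$ imply some $z$ with $Rxz$, $z\leq y$. Models add $V$ with $\leq$-upward closed values; forcing: atoms by $V$, $\top,\bot,\wedge,\vee$ pointwise, $x\Vdash A\supset B$ iff for all $x'\geq x$, $x'\Vdash A$ implies $x'\Vdash B$; $x\Vdash\square A$ iff $y\Vdash A$ for all $y$ with $Rxy$; $x\Vdash\lozenge A$ iff $y\Vdash A$ for some $y$ with $Rxy$. Bi-nested sequents: the empty sequent $\Rightarrow$ is a sequent; $\Gamma\Rightarrow B_1,\dots,B_k,[S_1],\dots,[S_m],\langle T_1\rangle,\dots,\langle T_n\rangle$ is a sequent, where $\Gamma$ is a finite multiset of formulas, $B_i$ formulas, $S_i,T_j$ sequents ($[S]$: modal block, $\langle T\rangle$: implication block). Contexts: $\{\}$ is a context; if $\Gamma\Rightarrow\Delta$ is a sequent and $G'\{\}$ a context then $\Gamma\Rightarrow\Delta,\langle G'\{\}\rangle$ and $\Gamma\Rightarrow\Delta,[G'\{\}]$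 are contexts; $G\{S\}$ fills the hole with $S$. For a succedent $\Theta=\Theta_0,[\Phi_1\Rightarrow\Psi_1],\dots,[\Phi_k\Rightarrow\Psi_k]$ with $\Theta_0$ containing no modal blocks at top level, $\Theta^\flat=[\Phi_1\Rightarrow\Psi_1^\flat],\dots,[\Phi_k\Rightarrow\Psi_k^\flat]$ (empty if $k=0$), and $\Rightarrow\Theta^\#$ is the sequent $\Rightarrow Fm(\Theta_0),[\Rightarrow\Psi_1^\#],\dots,[\Rightarrow\Psi_k^\#]$, $Fm(\Theta_0)$ the formulas directly in $\Theta_0$. Rules of $\mathbf{C}_{\mathbf{LIK}}$ (premises / conclusion, $G$ any context): axioms $G\{\Gamma,\bot\Rightarrow\Delta\}$, $G\{\Gamma\Rightarrow\top,\Delta\}$, $G\{\Gamma,p\Rightarrow\Delta,p\}$ ($p$ atom); $(\wedge_L)$ $G\{A,B,\Gamma\Rightarrow\Delta\}$ / $G\{A\wedge B,\Gamma\Rightarrow\Delta\}$; $(\wedge_R)$ $G\{\Gamma\Rightarrow\Delta,A\}$, $G\{\Gamma\Rightarrow\Delta,B\}$ / $G\{\Gamma\Rightarrow\Delta,A\wedge B\}$; $(\vee_L)$ $G\{\Gamma,A\Rightarrow\Delta\}$, $G\{\Gamma,B\Rightarrow\Delta\}$ / $G\{\Gamma,A\vee B\Rightarrow\Delta\}$; $(\vee_R)$ $G\{\Gamma\Rightarrow\Delta,A,B\}$ / $G\{\Gamma\Rightarrow\Delta,A\vee B\}$; $(\supset_L)$ $G\{\Gamma,A\supset B\Rightarrow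 A,\Delta\}$, $G\{\Gamma,B\Rightarrow\Delta\}$ / $G\{\Gamma,A\supset B\Rightarrow\Delta\}$; $(\supset_R)$ $G\{\Gamma\Rightarrow\Delta,\langle A\Rightarrow B\rangle\}$ / $G\{\Gamma\Rightarrow\Delta,A\supset B\}$; $(\square_L)$ $G\{\Gamma,\square A\Rightarrow\Delta,[\Sigma,A\Rightarrow\Pi]\}$ / $G\{\Gamma,\square A\Rightarrow\Delta,[\Sigma\Rightarrow\Pi]\}$; $(\square_R)$ $G\{\Gamma\Rightarrow\Delta,[\Rightarrow A]\}$ / $G\{\Gamma\Rightarrow\Delta,\square A\}$; $(\lozenge_L)$ $G\{\Gamma\Rightarrow\Delta,[A\Rightarrow]\}$ / $G\{\Gamma,\lozenge A\Rightarrow\Delta\}$; $(\lozenge_R)$ $G\{\Gamma\Rightarrow\Delta,\lozenge A,[\Sigma\Rightarrow\Pi,A]\}$ / $G\{\Gamma\Rightarrow\Delta,\lozenge A,[\Sigma\Rightarrow\Pi]\}$; (trans) $G\{\Gamma,\Gamma'\Rightarrow\Delta,\langle\Gamma',\Sigma\Rightarrow\Pi\rangle\}$ / $G\{\Gamma,\Gamma'\Rightarrow\Delta,\langle\Sigma\Rightarrow\Pi\rangle\}$; $(\mathrm{inter}_\rightarrow)$ $G\{\Gamma\Rightarrow\Delta,\langle\Sigma\Rightarrow\Pi,[\Lambda\Rightarrow\Theta^\flat]\rangle,[\Lambda\Rightarrow\Theta]\}$ / $G\{\Gamma\Rightarrow\Delta,\langle\Sigma\Rightarrow\Pi\rangle,[\Lambda\Rightarrow\Theta]\}$;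 $(\mathrm{inter}_\downarrow)$ $G\{\Gamma\Rightarrow\Delta,\langle\Sigma\Rightarrow\Pi,[\Lambda\Rightarrow\Theta]\rangle,[\Rightarrow\Theta^\#]\}$ / $G\{\Gamma\Rightarrow\Delta,\langle\Sigma\Rightarrow\Pi,[\Lambda\Rightarrow\Theta]\rangle\}$. A sequent is provable if it is the root of a finite tree of rule instances whose leaves are axioms. Forcing of sequents: $x\not\Vdash\emptyset$; $x\Vdash[T]$ iff $y\Vdash T$ for all $y$ with $Rxy$; $x\Vdash\langle T\rangle$ iff $x'\Vdash T$ for all $x'\geq x$; $x\Vdash\Gamma\Rightarrow\Delta$ iff $x\not\Vdash A$ for some $A\in\Gamma$ or $x\Vdash\mathcal{O}$ for some formula or block $\mathcal{O}\in\Delta$. *)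

(* Defs.v *)
From Stdlib Require Import List Permutation.
Import ListNotations.

Set Implicit Arguments.
Unset Strict Implicit.

Section Syntax.
Variable Atom : Type.

Inductive form : Type :=
  | Var (p : Atom)
  | Imp (A B : form)
  | Top
  | Bot
  | Or (A B : form)
  | And (A B : form)
  | Box (A : form)
  | Dia (A : form).

(* Finite multisets are represented by lists; they are identified up to
   reordering, at every nesting depth, by [seq_eqv] below. *)
Inductive sequent : Type :=
  | Seq (Gamma : list form) (Delta : list item)
with item : Type :=
  | Fm (A : form)
  | MBlock (S : sequent)  (* [S] *)
  | IBlock (T : sequent). (* <T> *)

Inductive seq_eqv : sequent -> sequent -> Prop :=
  | seq_eqv_intro Gamma Gamma' Delta Delta' Delta'' :
      Permutation Gamma Gamma' ->
      Permutation Delta Delta'' -> Forall2 item_eqv Delta'' Delta' ->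
      seq_eqv (Seq Gamma Delta) (Seq Gamma' Delta')
with item_eqv : item -> item -> Prop :=
  | Fm_eqv A : item_eqv (Fm A) (Fm A)
  | MBlock_eqv S S' : seq_eqv S S' -> item_eqv (MBlock S) (MBlock S')
  | IBlock_eqv T T' : seq_eqv T T' -> item_eqv (IBlock T) (IBlock T').

Inductive context : Type :=
  | Hole
  | CtxI (Gamma : list form) (Delta : list item) (G : context)
  | CtxM (Gamma : list form) (Delta : list item) (G : context).

Fixpoint fill (G : context) (S : sequent) : sequent :=
  match G with
  | Hole => S
  | CtxI Gamma Delta G' => Seq Gamma (IBlock (fill G' S) :: Delta)
  | CtxM Gamma Delta G' => Seq Gamma (MBlock (fill G' S) :: Delta)
  end.

Fixpoint flat_item (o : item) : list item :=
  match o with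
  | MBlock (Seq Phi Psi) => [MBlock (Seq Phi (flat_map flat_item Psi))]
  | Fm _ | IBlock _ => []
  end.

Definition flat (Theta : list item) : list item := flat_map flat_item Theta.

Fixpoint sharp_item (o : item) : list item :=
  match o with
  | Fm A => [Fm A]
  | MBlock (Seq _ Psi) => [MBlock (Seq [] (flat_map sharp_item Psi))]
  | IBlock _ => []
  end.

Definition sharp (Theta : list item) : list item := flat_map sharp_item Theta.

(* [rule Ps C]: the rule instance with premises [G{P}], [P] in [Ps], and
   conclusion [G{C}]; the surrounding context [G] is added in [provable].
   Axioms are the instances without premises. *)
Inductive rule : list sequent -> sequent -> Prop :=
  | ax_bot Gamma Delta :
      rule [] (Seq (Bot :: Gamma) Delta)
  | ax_top Gamma Delta :
      rule [] (Seq Gamma (Fm Top :: Delta))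
  | ax_id p Gamma Delta :
      rule [] (Seq (Var p :: Gamma) (Fm (Var p) :: Delta))
  | and_L A B Gamma Delta :
      rule [Seq (A :: B :: Gamma) Delta]
           (Seq (And A B :: Gamma) Delta)
  | and_R A B Gamma Delta :
      rule [Seq Gamma (Fm A :: Delta); Seq Gamma (Fm B :: Delta)]
           (Seq Gamma (Fm (And A B) :: Delta))
  | or_L A B Gamma Delta :
      rule [Seq (A :: Gamma) Delta; Seq (B :: Gamma) Delta]
           (Seq (Or A B :: Gamma) Delta)
  | or_R A B Gamma Delta :
      rule [Seq Gamma (Fm A :: Fm B :: Delta)]
           (Seq Gamma (Fm (Or A B) :: Delta))
  | imp_L A B Gamma Delta :
      rule [Seq (Imp A B :: Gamma) (Fm A :: Delta); Seq (B :: Gamma) Delta]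
           (Seq (Imp A B :: Gamma) Delta)
  | imp_R A B Gamma Delta :
      rule [Seq Gamma (IBlock (Seq [A] [Fm B]) :: Delta)]
           (Seq Gamma (Fm (Imp A B) :: Delta))
  | box_L A Gamma Delta Sigma Pi :
      rule [Seq (Box A :: Gamma) (MBlock (Seq (A :: Sigma) Pi) :: Delta)]
           (Seq (Box A :: Gamma) (MBlock (Seq Sigma Pi) :: Delta))
  | box_R A Gamma Delta :
      rule [Seq Gamma (MBlock (Seq [] [Fm A]) :: Delta)]
           (Seq Gamma (Fm (Box A) :: Delta))
  | dia_L A Gamma Delta :
      rule [Seq Gamma (MBlock (Seq [A] []) :: Delta)]
           (Seq (Dia A :: Gamma) Delta)
  | dia_R A Gamma Delta Sigma Pi :
      rule [Seq Gamma (Fm (Dia A) :: MBlock (Seq Sigma (Fm A :: Pi)) :: Delta)]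
           (Seq Gamma (Fm (Dia A) :: MBlock (Seq Sigma Pi) :: Delta))
  | trans Gamma Gamma' Delta Sigma Pi :
      rule [Seq (Gamma ++ Gamma') (IBlock (Seq (Gamma' ++ Sigma) Pi) :: Delta)]
           (Seq (Gamma ++ Gamma') (IBlock (Seq Sigma Pi) :: Delta))
  | inter_right Gamma Delta Sigma Pi Lambda Theta :
      rule [Seq Gamma
              (IBlock (Seq Sigma (MBlock (Seq Lambda (flat Theta)) :: Pi))
               :: MBlock (Seq Lambda Theta) :: Delta)]
           (Seq Gamma
              (IBlock (Seq Sigma Pi) :: MBlock (Seq Lambda Theta) :: Delta))
  | inter_down Gamma Delta Sigma Pi Lambda Theta :
      rule [Seq Gamma
              (IBlock (Seq Sigma (MBlock (Seq Lambda Theta) :: Pi))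
               :: MBlock (Seq [] (sharp Theta)) :: Delta)]
           (Seq Gamma
              (IBlock (Seq Sigma (MBlock (Seq Lambda Theta) :: Pi)) :: Delta)).

(* [provable_eqv] is not a rule of the calculus: it makes provability a
   property of multiset-based sequents rather than of their list
   representatives. *)
Inductive provable : sequent -> Prop :=
  | provable_rule G Ps C :
      rule Ps C -> (forall P, In P Ps -> provable (fill G P)) ->
      provable (fill G C)
  | provable_eqv S S' : seq_eqv S S' -> provable S -> provable S'.

End Syntax.

Arguments Top {Atom}.
Arguments Bot {Atom}.
Arguments Hole {Atom}.

Record frame : Type := Frame {
  world :> Type;
  le : world -> world -> Prop;
  acc : world -> world -> Prop;
  world_inhabited : inhabited world;
  le_refl : forall x, le x x;
  le_trans : forall x y z, le x y -> le y z -> le x z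
}.

Definition forward_confluent (F : frame) : Prop :=
  forall x x' y : F, le x x' -> acc x y -> exists y', acc x' y' /\ le y y'.

Definition downward_confluent (F : frame) : Prop :=
  forall x x' y : F, le x x' -> acc x' y -> exists z, acc x z /\ le z y.

Record model (Atom : Type) : Type := Model {
  frame_of :> frame;
  val : Atom -> frame_of -> Prop;
  val_upward : forall p x y, le x y -> val p x -> val p y
}.

Section Semantics.
Variables (Atom : Type) (M : model Atom).

Fixpoint force (x : M) (A : form Atom) : Prop :=
  match A with
  | Var p => val p x
  | Imp A B => forall x', le x x' -> force x' A -> force x' B
  | Top => True
  | Bot => False
  | Or A B => force x A \/ force x B
  | And A B => force x A /\ force x B
  | Box A => forall y, acc x y -> force y A
  | Dia A => exists y, acc x y /\ force y A
  end.

(* The [fold_right] says that some member of [Delta] is forced; it stands for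
   [Exists (force_item x) Delta], which the guard condition rejects. *)
Fixpoint force_seq (x : M) (S : sequent Atom) : Prop :=
  match S with
  | Seq Gamma Delta =>
      (exists A, In A Gamma /\ ~ force x A) \/
      fold_right (fun o P => force_item x o \/ P) False Delta
  end
with force_item (x : M) (o : item Atom) : Prop :=
  match o with
  | Fm A => force x A
  | MBlock T => forall y, acc x y -> force_seq y T
  | IBlock T => forall x', le x x' -> force_seq x' T
  end.

End Semantics.

Definition valid (Atom : Type) (S : sequent Atom) : Prop :=
  forall M : model Atom,
    forward_confluent M -> downward_confluent M ->
    forall x : M, force_seq x S.

(* Main.v *)
From Stdlib Require Import List Permutation Classical.
Require Import Defs.
Import ListNotations.

(** Every rule is sound world by world: if all premises are forced at [x], so is
    the conclusion.  Classically this property passes through contexts.  The two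
    interaction rules rest on moving succedents along the preorder: a forced
    [flat Theta] can be pulled down to [Theta] by forward confluence, and a forced
    [sharp Theta] can be pushed up to [Theta] by downward confluence. *)

(** The generated induction principle gives no hypothesis for items inside a list. Only modal blocks
    receive one here, matching the recursion of [flat_item] and [sharp_item], which stop at
    implication blocks. *)
Lemma item_modal_ind (Atom : Type) (P : item Atom -> Prop) :
  (forall A, P (Fm A)) -> (forall T, P (IBlock T)) ->
  (forall Phi Psi, Forall P Psi -> P (MBlock (Seq Phi Psi))) ->
  forall o, P o.
Proof.
  intros HF HI HM.
  fix IH 1; intros [A | [Phi Psi] | T].
  - apply HF.
  - apply HM; induction Psi as [| o Psi IHPsi]; constructor.
    + apply IH.
    + exact IHPsi.
  - apply HI.
Qed.

Section Soundness.
Variables (Atom : Type) (M : model Atom).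

Lemma force_seqE (x : M) Gamma Delta :
  force_seq x (Seq Gamma Delta) <->
  (exists A, In A Gamma /\ ~ force x A) \/ Exists (force_item x) Delta.
Proof.
  assert (E : fold_right (fun o P => force_item x o \/ P) False Delta <->
              Exists (force_item x) Delta).
  { induction Delta as [| o Delta IH]; simpl.
    - now rewrite Exists_nil.
    - now rewrite Exists_cons, IH. }
  simpl; now rewrite E.
Qed.

Lemma seq_eqv_force (S S' : sequent Atom) :
  seq_eqv S S' -> forall x : M, force_seq x S -> force_seq x S'
with item_eqv_force (o o' : item Atom) :
  item_eqv o o' -> forall x : M, force_item x o -> force_item x o'.
Proof.
  - intros [Gamma Gamma' Delta Delta' Delta'' HG HD HF] x.
    rewrite !force_seqE; intros [[A [HA HnA]] | HE].
    + left; exists A; split; [now apply (Permutation_in _ HG) | exact HnA].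
    + right.
      assert (HE' : Exists (force_item x) Delta'').
      { apply Exists_exists in HE as [o [Ho Hx]].
        apply Exists_exists; exists o; split; [| exact Hx].
        now apply (Permutation_in _ HD). }
      (* The inner induction on the [Forall2] derivation keeps the recursive call to
         [item_eqv_force] on a subderivation, as the guard condition demands. *)
      clear HD HE; induction HF as [| o o' l l' Ho HF IH].
      * inversion HE'.
      * apply Exists_cons in HE' as [Hx | HE'].
        -- apply Exists_cons_hd; exact (item_eqv_force _ _ Ho x Hx).
        -- apply Exists_cons_tl; exact (IH HE').
  - intros [A | T T' HT | T T' HT] x; simpl.
    + trivial.
    + intros H y Hy; exact (seq_eqv_force _ _ HT y (H y Hy)).
    + intros H y Hy; exact (seq_eqv_force _ _ HT y (H y Hy)).
Qed.

(** Either the side formulas and blocks of the context already force the sequent at [x], or every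
    premise must be forced through its block, hence at each world the block reaches. That is why the
    hypothesis ranges over all worlds. *)
Lemma force_fill (G : context Atom) (Ps : list (sequent Atom)) (C : sequent Atom) :
  (forall x : M, (forall P, In P Ps -> force_seq x P) -> force_seq x C) ->
  forall x : M, (forall P, In P Ps -> force_seq x (fill G P)) ->
  force_seq x (fill G C).
Proof.
  intros HC; induction G as [| Gamma Delta G IH | Gamma Delta G IH];
    intros x HPs; cbn [fill] in *.
  - now apply HC.
  - destruct (classic (force_seq x (Seq Gamma Delta))) as [H | H];
      rewrite force_seqE in *; rewrite Exists_cons; [tauto |].
    right; left; intros y Hy; apply IH; intros P HP.
    specialize (HPs P HP); rewrite force_seqE, Exists_cons in HPs.
    destruct HPs as [HP' | [HP' | HP']]; [tauto | now apply HP' | tauto].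
  - destruct (classic (force_seq x (Seq Gamma Delta))) as [H | H];
      rewrite force_seqE in *; rewrite Exists_cons; [tauto |].
    right; left; intros y Hy; apply IH; intros P HP.
    specialize (HPs P HP); rewrite force_seqE, Exists_cons in HPs.
    destruct HPs as [HP' | [HP' | HP']]; [tauto | now apply HP' | tauto].
Qed.

Hypothesis fwd : forward_confluent M.
Hypothesis dwn : downward_confluent M.

(** [Box] and [Dia] are evaluated without looking along the preorder, so persistence comes from
    downward confluence for the former and forward confluence for the latter. *)
Lemma force_upward A (x y : M) : le x y -> force x A -> force y A.
Proof.
  revert x y; induction A as [p | A IHA B IHB | | | A IHA B IHB | A IHA B IHB
                             | A IHA | A IHA]; simpl; intros x y Hxy.
  - now apply val_upward.
  - intros H z Hz; apply H; exact (le_trans Hxy Hz).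
  - trivial.
  - trivial.
  - intros [H | H]; [left; now apply (IHA x) | right; now apply (IHB x)].
  - intros [HA HB]; split; [now apply (IHA x) | now apply (IHB x)].
  - intros H z Hz; destruct (dwn _ _ _ Hxy Hz) as [w [Hw Hwz]].
    exact (IHA _ _ Hwz (H w Hw)).
  - intros [z [Hz HA]]; destruct (fwd _ _ _ Hxy Hz) as [w [Hw Hzw]].
    exists w; split; [exact Hw | exact (IHA _ _ Hzw HA)].
Qed.

(** No order between [x] and [y] is assumed, so this serves both [flat] (downward) and [sharp]
    (upward). *)
Lemma Exists_flat_map_reflect (f : item Atom -> list (item Atom)) (x y : M) Theta :
  Forall (fun o => Exists (force_item y) (f o) -> force_item x o) Theta ->
  Exists (force_item y) (flat_map f Theta) -> Exists (force_item x) Theta.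
Proof.
  intros HT; rewrite Exists_flat_map.
  induction HT as [| o Theta Ho HT IH]; rewrite ?Exists_cons, ?Exists_nil; tauto.
Qed.

Lemma flat_item_downward o (x y : M) :
  le x y -> Exists (force_item y) (flat_item o) -> force_item x o.
Proof.
  revert x y; induction o as [A | T | Phi Psi IH] using item_modal_ind;
    intros x y Hxy; cbn [flat_item]; rewrite ?Exists_cons, ?Exists_nil; try tauto.
  intros [H | []] z Hz.
  destruct (fwd _ _ _ Hxy Hz) as [w [Hw Hzw]].
  specialize (H w Hw); rewrite force_seqE in *; destruct H as [[A [HA HnA]] | H].
  (* Antecedents survive in [flat] because failure of a formula is inherited downward. *)
  - left; exists A; split; [exact HA | intros HzA].
    exact (HnA (force_upward _ _ _ Hzw HzA)).
  - right; revert H; apply Exists_flat_map_reflect.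
    revert IH; apply Forall_impl; intros o Ho; exact (Ho _ _ Hzw).
Qed.

Lemma sharp_item_upward o (x y : M) :
  le x y -> Exists (force_item x) (sharp_item o) -> force_item y o.
Proof.
  revert x y; induction o as [A | T | Phi Psi IH] using item_modal_ind;
    intros x y Hxy; cbn [sharp_item]; rewrite ?Exists_cons, ?Exists_nil.
  - intros [H | []]; exact (force_upward _ _ _ Hxy H).
  - tauto.
  - intros [H | []] z Hz.
    destruct (dwn _ _ _ Hxy Hz) as [w [Hw Hwz]].
    (* Failure of an antecedent formula need not persist upward; since [sharp] empties the
       antecedent, this alternative is void. *)
    specialize (H w Hw); rewrite force_seqE in *; destruct H as [[A [[] _]] | H].
    right; revert H; apply Exists_flat_map_reflect.
    revert IH; apply Forall_impl; intros o Ho; exact (Ho _ _ Hwz).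
Qed.

Lemma flat_downward Theta (x y : M) :
  le x y -> Exists (force_item y) (flat Theta) -> Exists (force_item x) Theta.
Proof.
  intros Hxy; apply Exists_flat_map_reflect, Forall_forall.
  intros o _; now apply flat_item_downward.
Qed.

Lemma sharp_upward Theta (x y : M) :
  le x y -> Exists (force_item x) (sharp Theta) -> Exists (force_item y) Theta.
Proof.
  intros Hxy; apply Exists_flat_map_reflect, Forall_forall.
  intros o _; now apply sharp_item_upward.
Qed.

Lemma force_seq_imp (x : M) Gamma Delta :
  force_seq x (Seq Gamma Delta) <->
  (Forall (force x) Gamma -> Exists (force_item x) Delta).
Proof.
  rewrite force_seqE, Forall_forall; split.
  - intros [[A [HA HnA]] | H] HG; [destruct (HnA (HG A HA)) | exact H].
  - intros H; destruct (classic (exists A, In A Gamma /\ ~ force x A)) as [| HN];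
      [tauto |].
    right; apply H; intros A HA; apply NNPP; intros HnA; apply HN; now exists A.
Qed.

Lemma force_MBlock (x : M) T :
  force_item x (MBlock T) <-> forall y, acc x y -> force_seq y T.
Proof. reflexivity. Qed.

Lemma force_IBlock (x : M) T :
  force_item x (IBlock T) <-> forall y, le x y -> force_seq y T.
Proof. reflexivity. Qed.

Lemma rule_sound (Ps : list (sequent Atom)) C :
  rule Ps C ->
  forall x : M, (forall P, In P Ps -> force_seq x P) -> force_seq x C.
Proof.
  intros HR x HPs; rewrite <- Forall_forall in HPs; revert HPs.
  (* With sequents read as implications, [tauto] settles the axioms and the rules for conjunction
     and disjunction. The bullets are [imp_L] to [inter_down], in order of declaration. *)
  destruct HR; rewrite ?Forall_cons_iff, ?force_seq_imp, ?Forall_cons_iff,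
                       ?Exists_cons, ?force_MBlock, ?force_IBlock;
    cbn [force_item force]; intros HPs; try tauto.
  - intros [HAB HG].
    pose proof (HAB x (le_refl x)); tauto.
  - intros HG; destruct HPs as [HPs _]; destruct (HPs HG) as [H | H]; [| tauto].
    left; intros y Hy HA.
    specialize (H y Hy); rewrite force_seq_imp, Exists_cons, Exists_nil in H.
    destruct H as [H | []]; [repeat constructor; exact HA | exact H].
  - intros [HB HG]; destruct HPs as [HPs _].
    destruct HPs as [H | H]; [tauto | | tauto].
    left; intros y Hy; specialize (H y Hy).
    rewrite force_seq_imp, ?Forall_cons_iff in *.
    specialize (HB y Hy); tauto.
  - intros HG; destruct HPs as [HPs _]; destruct (HPs HG) as [H | H]; [| tauto].
    left; intros y Hy.
    specialize (H y Hy); rewrite force_seq_imp, Exists_cons, Exists_nil in H.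
    destruct H as [H | []]; [constructor | exact H].
  - intros [[y [Hy HA]] HG]; destruct HPs as [HPs _].
    destruct (HPs HG) as [H | H]; [| tauto].
    specialize (H y Hy); rewrite force_seq_imp, Exists_nil in H.
    destruct H; repeat constructor; exact HA.
  - intros HG; destruct HPs as [HPs _].
    destruct (classic (exists y, acc x y /\ force y A)) as [HD | HD]; [tauto |].
    destruct (HPs HG) as [H | [H | H]]; [tauto | | tauto].
    right; left; intros y Hy; specialize (H y Hy).
    rewrite force_seq_imp, ?Exists_cons in *; intros HS.
    destruct (H HS) as [HA | HP]; [| exact HP].
    destruct HD; exists y; split; assumption.
  - intros HG; destruct HPs as [HPs _].
    destruct (HPs HG) as [H | H]; [| tauto].
    left; intros y Hy; specialize (H y Hy).
    rewrite force_seq_imp, ?Forall_app in *; intros HS; apply H; split; [| exact HS].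
    destruct HG as [_ HG]; revert HG; apply Forall_impl.
    intros A; now apply force_upward.
  - intros HG; destruct HPs as [HPs _].
    (* If the modal block fails at [x], the block added inside the implication block cannot hold at
       any [x'] above [x]: pulling its [flat] succedent down would make the original block hold. *)
    destruct (classic (forall y, acc x y -> force_seq y (Seq Lambda Theta)))
      as [HM | HM]; [tauto |].
    destruct (HPs HG) as [H | [H | H]]; [| tauto | tauto].
    left; intros x' Hx; specialize (H x' Hx).
    rewrite force_seq_imp, ?Exists_cons in *; intros HS.
    destruct (H HS) as [HB | HP]; [| exact HP].
    destruct HM; intros y Hy; destruct (fwd _ _ _ Hx Hy) as [y' [Hy' Hyy']].
    specialize (HB y' Hy'); rewrite force_seq_imp in *; intros HL.
    apply (flat_downward _ _ _ Hyy'), HB.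
    revert HL; apply Forall_impl; intros A; now apply force_upward.
  - intros HG; destruct HPs as [HPs _].
    (* The remaining case has the [sharp] block forced at [x]; pushing its succedent up forces the
       modal block at every [x'] above [x]. *)
    destruct (HPs HG) as [H | [H | H]]; [tauto | | tauto].
    left; intros x' Hx; rewrite force_seq_imp, Exists_cons; intros HS.
    left; intros y Hy; destruct (dwn _ _ _ Hx Hy) as [z [Hz Hzy]].
    specialize (H z Hz); rewrite force_seq_imp in *; intros HL.
    apply (sharp_upward _ _ _ Hzy), H; constructor.
Qed.

End Soundness.

Theorem theorem3 (Atom : Type) (S : sequent Atom) :
  provable S -> valid S.
Proof.
  intros HS M fwd dwn.
  induction HS as [G Ps C HR _ IH | S S' HSS' _ IH]; intros x.
  - apply (force_fill _ _ G Ps); [| intros P HP; now apply IH].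
    now apply rule_sound.
  - exact (seq_eqv_force _ _ _ _ HSS' x (IH x)).
Qed.
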